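(* Let $C(q)$ be a formal power series with $C(0)=1$, let $c_j:=[q^j]\,\frac{1}{C(q)}$ for $j\ge 0$ and $c_j:=0$ for $j<0$, and let $(s_{n,k})_{n\ge1,\,1\le k\le n}$ be such that for every sequence $\{a_n\}_{n\ge1}$ \[ \sum_{n\ge 1}\frac{a_n q^n}{1-q^n}=\frac{1}{C(q)}\sum_{n\ge 1}\Big(\sum_{k=1}^n s_{n,k}a_k\Big)q^n . \] Let $s^{(-1)}_{n,k}$ denote the entries of the inverse of the lower-triangular matrix $(s_{i,j})_{1\le i,j\le N}$ (with $s_{i,j}=0$ for $j>i$; the entries $s^{(-1)}_{n,k}$ do not depend on $N\ge n$, and $s^{(-1)}_{n,k}=0$ for $k>n$). For a sequence $\{a_n\}_{n\ge1}$ put $b_m:=\sum_{d\mid m}a_d$ and $B_{m}:=\sum_{k=1}^{m+1}s_{m+1,k}a_k$ for $m\ge 0$. Then for all integers $n,k\ge 1$ with $1\le k\le n$ and all $m\ge 0$: \[ \text{(i)}\quad s^{(-1)}_{n,k}=\sum_{d\mid n}c_{d-k}\,\mu(n/d);\qquad \text{(ii)}\quad c_{n-k}=\sum_{d\mid n}s^{(-1)}_{d,k}; \] \[ \text{(iii)}\quad B_m=b_{m+1}+\sum_{k=1}^{m}[q^k]C(q)\cdot b_{m+1-k}. \]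
   Context: $\mu$ is the Möbius function and $[q^j]F(q)$ denotes the coefficient of $q^j$ in a formal power series $F$. The matrix $(s_{i,j})$ is lower triangular with all diagonal entries equal to $1$, hence invertible. *)

(* Defs.v *)
From mathcomp Require Import all_boot all_order all_algebra.
Set Implicit Arguments.
Unset Strict Implicit.
Unset Printing Implicit Defensive.
Import GRing.Theory.
Local Open Scope ring_scope.

(* A formal power series F(q) is its coefficient function: F j is [q^j] F. *)
Definition fps (R : Type) : Type := nat -> R.

Section FormalPowerSeries.
Variable R : comUnitRingType.
Implicit Types F G : fps R.

Definition fps_one : fps R := fun j => (j == 0%N)%:R.
Definition fps_Xn (n : nat) : fps R := fun j => (j == n)%:R.
Definition fps_sub F G : fps R := fun j => F j - G j.
Definition fps_scale (a : R) F : fps R := fun j => a * F j.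
Definition fps_mul F G : fps R := fun j => \sum_(i < j.+1) F i * G (j - i)%N.

(* The coefficients D 0, ..., D n of D = 1 / F, obtained by solving
   F 0 * D n + \sum_(i < n) F (n - i) * D i = (n == 0) for D n. *)
Fixpoint fps_inv_seq F (n : nat) : seq R :=
  if n is m.+1 then
    let D := fps_inv_seq F m in
    rcons D (- ((F 0%N)^-1 * \sum_(i < m.+1) F (m.+1 - i)%N * D`_i))
  else [:: (F 0%N)^-1].

(* 1 / F; meaningful when F 0 is a unit, see fps_mulrV. *)
Definition fps_inv F : fps R := fun n => (fps_inv_seq F n)`_n.

Lemma size_fps_inv_seq F n : size (fps_inv_seq F n) = n.+1.
Proof. by elim: n => //= n IHn; rewrite size_rcons IHn. Qed.

Lemma nth_fps_inv_seq F n i : (i <= n)%N -> (fps_inv_seq F n)`_i = fps_inv F i.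
Proof.
elim: n => [|n IHn]; first by rewrite leqn0 => /eqP->.
rewrite leq_eqVlt => /predU1P[-> //|lt_in].
by rewrite /= nth_rcons size_fps_inv_seq lt_in IHn.
Qed.

Lemma fps_mulrV F : F 0%N \is a GRing.unit -> fps_mul F (fps_inv F) =1 fps_one.
Proof.
move=> uF [|n]; rewrite /fps_mul /fps_one.
  by rewrite big_ord1 /fps_inv /= mulrV.
rewrite big_ord_recl subn0 {1}/fps_inv /= nth_rcons size_fps_inv_seq ltnn eqxx.
rewrite mulrN mulrA mulrV // mul1r; apply/eqP; rewrite addrC subr_eq0; apply/eqP.
rewrite (reindex_inj rev_ord_inj) /=; apply: eq_bigr => i _.
have le_in : (i <= n)%N by rewrite -ltnS.
rewrite nth_fps_inv_seq // /bump add1n !subSS subSn //.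
by rewrite subKn.
Qed.

(* \sum_(n >= 1) F n = S, convergence being coefficientwise stabilization of
   the partial sums (i.e., convergence in the q-adic topology). *)
Definition fps_sums_to (F : nat -> fps R) (S : fps R) : Prop :=
  forall j, exists N, forall M, (N <= M)%N -> \sum_(1 <= n < M) F n j = S j.

(* a_n q^n / (1 - q^n) *)
Definition lambert_term (a : nat -> R) (n : nat) : fps R :=
  fps_scale (a n) (fps_mul (fps_Xn n) (fps_inv (fps_sub fps_one (fps_Xn n)))).

(* \sum_(n >= 1) (\sum_(1 <= k <= n) s_{n,k} a_k) q^n *)
Definition factor_series (s : nat -> nat -> R) (a : nat -> R) : fps R :=
  fun n => if n is 0%N then 0 else \sum_(1 <= k < n.+1) s n k * a k.

(* Only the values a n with 1 <= n and s n k with 1 <= k <= n matter. *)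
Definition lambert_factorization (C : fps R) (s : nat -> nat -> R) : Prop :=
  forall a : nat -> R,
    fps_sums_to (lambert_term a) (fps_mul (fps_inv C) (factor_series s a)).

(* c_j for j : int, with c_j = 0 for j < 0. *)
Definition inv_coef (C : fps R) (j : int) : R :=
  if j is Posz m then fps_inv C m else 0.

(* (s_{i,j})_{1 <= i, j <= N}: the ordinals are shifted by one. *)
Definition s_matrix (s : nat -> nat -> R) (N : nat) : 'M[R]_N :=
  \matrix_(i < N, j < N) if (j <= i)%N then s i.+1 j.+1 else 0.

(* The entry in row n and column k, both counted from 1. *)
Definition mx_entry (N : nat) (A : 'M[R]_N) (n k : nat) : R :=
  if (insub n.-1, insub k.-1) is (Some i, Some j) then A i j else 0.

(* s^{(-1)}_{n,k}, read off the truncation at size N.  The default value of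
   invmx on singular matrices is never used: lambert_factorization C s with
   C 0 = 1 forces s n n = 1 for n >= 1. *)
Definition s_inv (s : nat -> nat -> R) (N n k : nat) : R :=
  mx_entry (invmx (s_matrix s N)) n k.

Definition divisor_sum (a : nat -> R) (m : nat) : R := \sum_(d <- divisors m) a d.

End FormalPowerSeries.

Definition squarefree (n : nat) : bool :=
  (0 < n)%N && all (fun p => logn p n == 1%N) (primes n).

Definition moebius (n : nat) : int :=
  if squarefree n then (-1) ^+ size (primes n) else 0.

(* Main.v *)
Require Import Defs.
From mathcomp Require Import all_boot all_order all_algebra.
Set Implicit Arguments.
Unset Strict Implicit.
Import GRing.Theory.
Local Open Scope ring_scope.

(** Since [q^n/(1-q^n)] is the indicator of the positive multiples of [n], the
    factorization says that [1/C] times the factor series has coefficients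
    [b_m]; multiplying by [C] gives (iii).  Applied to the sequences
    [a_n = [n = k]] it becomes the matrix identity [T S = D], where
    [T = (c_{i-j})], [S = (s_{i,j})] and [D = ([j | i])].  Moebius inversion
    says that [D M = 1] for [M = ([j | i] mu(i/j))], so [S^-1 = M T], which is
    (i), and [D S^-1 = T], which is (ii). *)

(** * Squarefree numbers and the Moebius function *)

Lemma squarefreeP n :
  reflect (0 < n /\ forall p, prime p -> logn p n <= 1)%N (squarefree n).
Proof.
apply: (iffP andP) => -[n0 H]; split=> //.
  move=> p pp; have [pn|pn] := boolP (p \in primes n).
    by rewrite (eqP (allP H p pn)).
  by move: pn; rewrite -logn_gt0 -leqNgt => /leq_trans->.
apply/allP => p pn; have pp : prime p by move: pn; rewrite mem_primes => /and3P[].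
by rewrite eqn_leq H // logn_gt0.
Qed.

Lemma squarefree_pmul p d : prime p -> ~~ (p %| d)%N -> (0 < d)%N ->
  squarefree (p * d) = squarefree d.
Proof.
move=> pp pd d0; have p0 := prime_gt0 pp.
apply/squarefreeP/squarefreeP => -[_ H]; split=> //.
- by move=> q qq; apply: leq_trans (H q qq); rewrite lognM // leq_addl.
- by rewrite muln_gt0 p0.
move=> q qq; rewrite lognM // logn_prime //; have [->|_] := eqVneq q p; last exact: H.
by rewrite lognE (negPf pd) !andbF.
Qed.

(** The list [primes (p * d)] is [primes d] with the one new prime [p], so the sign flips. *)
Lemma moebius_pmul p d : prime p -> ~~ (p %| d)%N -> (0 < d)%N ->
  moebius (p * d) = - moebius d.
Proof.
move=> pp pd d0; have p0 := prime_gt0 pp.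
rewrite /moebius squarefree_pmul //; case: ifP => _; last by rewrite oppr0.
suff /perm_size-> : perm_eq (primes (p * d)) (p :: primes d).
  by rewrite /= exprS mulN1r.
apply: uniq_perm; rewrite ?primes_uniq //=.
  by rewrite primes_uniq mem_primes (negPf pd) !andbF.
by move=> q; rewrite primesM // primes_prime // !inE.
Qed.

(** Otherwise the [p]-adic valuation of [d] would be at least 2. Hence [d %/ p] is a legitimate
    preimage of [d] under multiplication by [p] in the pairing of divisors below. *)
Lemma squarefree_dvd_ndvd_div p d : prime p -> (p %| d)%N -> squarefree d ->
  ~~ (p %| d %/ p)%N.
Proof.
move=> pp pd /squarefreeP[d0 /(_ p pp)]; apply: contraL => pdp.
have p0 := prime_gt0 pp; have dp0 : (0 < d %/ p)%N by rewrite divn_gt0 // dvdn_leq.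
rewrite -(divnK pd) lognM // (logn_prime p pp) eqxx addn1 -ltnNge.
by rewrite ltnS logn_gt0 mem_primes pp dp0.
Qed.

Lemma sum_moebius n : (0 < n)%N -> \sum_(d <- divisors n) moebius d = (n == 1)%:R.
Proof.
move=> n0; have [->|n1] := eqVneq n 1; first by rewrite big_seq1.
have pp : prime (pdiv n) by rewrite pdiv_prime // ltn_neqAle eq_sym n1.
set p := pdiv n in pp; have pn : (p %| n)%N := pdiv_dvd n.
have p0 := prime_gt0 pp.
(* Only squarefree divisors count; [d |-> p d] is a sign-reversing bijection
   from those not divisible by [p] to those divisible by [p]. *)
rewrite (bigID squarefree) /= [X in _ + X]big1 ?addr0; last first.
  by move=> d /negPf sd; rewrite /moebius sd.
rewrite (bigID (dvdn p)) /= -big_filter -[X in _ + X]big_filter.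
set s1 := [seq d <- _ | _ & _]; set s2 := [seq d <- _ | _ & _].
have s12 : perm_eq s1 [seq (p * d)%N | d <- s2].
  apply: uniq_perm; first by rewrite filter_uniq ?divisors_uniq.
    rewrite map_inj_uniq ?filter_uniq ?divisors_uniq // => x y /eqP.
    by rewrite eqn_pmul2l // => /eqP.
  move=> d; rewrite mem_filter -dvdn_divisors //.
  apply/andP/mapP => [[/andP[sd pd] dn]|[e]].
    have npd := squarefree_dvd_ndvd_div pp pd sd.
    have dE : (p * (d %/ p))%N = d by rewrite mulnC divnK.
    exists (d %/ p)%N => //; rewrite mem_filter -dvdn_divisors // npd andbT.
    have dp0 : (0 < d %/ p)%N.
      by rewrite divn_gt0 // dvdn_leq //; case/squarefreeP: sd.
    rewrite -(squarefree_pmul pp npd dp0) dE sd /=.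
    by apply: dvdn_trans dn; rewrite -{2}dE dvdn_mull.
  rewrite mem_filter -dvdn_divisors // => /andP[/andP[se pe] en] ->.
  have e0 := dvdn_gt0 n0 en.
  by rewrite squarefree_pmul // se dvdn_mulr // Gauss_dvd ?pn ?en ?prime_coprime.
rewrite (perm_big _ s12) big_map -big_split big_seq big1 // => d.
rewrite mem_filter -dvdn_divisors // => /andP[/andP[_ pd] /(dvdn_gt0 n0) d0].
by rewrite /= moebius_pmul // addNr.
Qed.

(** * Divisor sums over index ranges, and Moebius inversion *)

Lemma sum_divisors (V : nmodType) (f : nat -> V) n M : (0 < n < M)%N ->
  \sum_(d <- divisors n) f d = \sum_(1 <= d < M | (d %| n)%N) f d.
Proof.
case/andP=> n0 nM; rewrite -[RHS]big_filter; apply/perm_big/uniq_perm.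
- exact: divisors_uniq.
- by rewrite filter_uniq ?iota_uniq.
move=> d; rewrite mem_filter mem_index_iota -dvdn_divisors //.
apply/idP/andP => [dn|[]//]; rewrite dn (dvdn_gt0 n0 dn); split=> //.
by apply: leq_ltn_trans nM; apply: dvdn_leq.
Qed.

(** The form needed to compare with matrix products: the ordinal [j] stands for the candidate
    divisor [j.+1]. *)
Lemma sum_divisors_ord (V : nmodType) (f : nat -> V) n N : (0 < n <= N)%N ->
  \sum_(d <- divisors n) f d = \sum_(j < N) if (j.+1 %| n)%N then f j.+1 else 0.
Proof.
by move=> nN; rewrite (@sum_divisors _ f n N.+1) // big_mkcond big_add1 big_mkord.
Qed.

(** The divisors of [n] that are multiples of [k] are the [k * e] with [e] dividing [n %/ k], which
    reduces the sum to [sum_moebius] at [n %/ k]. If [k] does not divide [n], the sum is empty. *)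
Lemma sum_moebius_between n k : (0 < n)%N -> (0 < k)%N ->
  \sum_(d <- divisors n | (k %| d)%N) moebius (d %/ k)%N = (n == k)%:R.
Proof.
move=> n0 k0; have [kn|kn] := boolP (k %| n)%N; last first.
  rewrite big_seq_cond big1 => [|d /andP[]].
    by case: eqP kn => // ->; rewrite dvdnn.
  by rewrite -dvdn_divisors // => dn kd; rewrite (dvdn_trans kd dn) in kn.
have nk0 : (0 < n %/ k)%N by rewrite divn_gt0 // dvdn_leq.
rewrite -big_filter.
have mults : perm_eq [seq d <- divisors n | (k %| d)%N]
                     [seq (k * d)%N | d <- divisors (n %/ k)].
  apply: uniq_perm; first by rewrite filter_uniq ?divisors_uniq.
    by rewrite map_inj_uniq ?divisors_uniq // => x y /eqP; rewrite eqn_pmul2l // => /eqP.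
  move=> d; rewrite mem_filter -dvdn_divisors //.
  apply/andP/mapP => [[/dvdnP[e ->] en]|[e]].
    exists e; last by rewrite mulnC.
    by rewrite -dvdn_divisors // dvdn_divRL.
  by rewrite -dvdn_divisors // dvdn_divRL // mulnC => en ->; rewrite dvdn_mulr // mulnC.
rewrite (perm_big _ mults) big_map; under eq_bigr do rewrite mulKn //.
by rewrite sum_moebius // -(eqn_pmul2r k0) divnK // mul1n.
Qed.

(** * Power series arithmetic and the expansion of Lambert terms *)

Section PowerSeries.
Variable R : comUnitRingType.
Implicit Types F G H : fps R.

(** The coefficient at [j] only sees coefficients up to [j], so truncation is harmless and the ring
    laws can be inherited from polynomials. *)
Lemma fps_mul_coefM F G n j : (j < n)%N ->
  fps_mul F G j = ((\poly_(i < n) F i) * (\poly_(i < n) G i))`_j.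
Proof.
move=> jn; rewrite coefM; apply: eq_bigr => i _; rewrite !coef_poly.
by rewrite (leq_trans (ltn_ord i) jn) (leq_ltn_trans (leq_subr i j) jn).
Qed.

Lemma fps_mulC F G : fps_mul F G =1 fps_mul G F.
Proof. by move=> j; rewrite !(@fps_mul_coefM _ _ j.+1) // mulrC. Qed.

Lemma eq_fps_mull F F' G j : (forall i, (i <= j)%N -> F i = F' i) ->
  fps_mul F G j = fps_mul F' G j.
Proof. by move=> FF; apply: eq_bigr => i _; rewrite FF // -ltnS. Qed.

Lemma fps_mulA F G H : fps_mul F (fps_mul G H) =1 fps_mul (fps_mul F G) H.
Proof.
move=> j; pose P (A : fps R) := \poly_(i < j.+1) A i.
have mulE A B i : (i <= j)%N -> fps_mul A B i = (P A * P B)`_i.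
  by move=> ij; apply: fps_mul_coefM.
have coefP A i : (i <= j)%N -> (P A)`_i = A i by move=> ij; rewrite coef_poly ltnS ij.
(* Commutativity brings the nested product to the left, where [eq_fps_mull] can replace it by a
   polynomial product agreeing with it up to degree [j]. *)
rewrite fps_mulC (@eq_fps_mull _ (fun i => (P G * P H)`_i)); last by move=> i /mulE.
rewrite (@eq_fps_mull (fps_mul F G) (fun i => (P F * P G)`_i)); last by move=> i /mulE.
transitivity ((P F * P G * P H)`_j).
  rewrite -mulrA (mulrC (P F)) coefM; apply: eq_bigr => i _.
  by rewrite (coefP F) // leq_subr.
by rewrite coefM; apply: eq_bigr => i _; rewrite (coefP H) // leq_subr.
Qed.

Lemma fps_mul1 F : fps_mul (@fps_one R) F =1 F.
Proof.
move=> j; rewrite /fps_mul big_ord_recl /fps_one eqxx mul1r subn0.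
by rewrite big1 ?addr0 // => i _; rewrite mul0r.
Qed.

Lemma fps_inv_unique F G : F 0%N \is a GRing.unit ->
  fps_mul F G =1 @fps_one R -> fps_inv F =1 G.
Proof.
move=> uF FG j.
transitivity (fps_mul (fps_mul F G) (fps_inv F) j).
  by rewrite (@eq_fps_mull _ (@fps_one R)) ?fps_mul1.
rewrite fps_mulC fps_mulA -[RHS]fps_mul1; apply: eq_fps_mull => i _.
by rewrite fps_mulC fps_mulrV.
Qed.

Lemma fps_Xn_mul n F j :
  fps_mul (@fps_Xn R n) F j = if (n <= j)%N then F (j - n)%N else 0.
Proof.
rewrite /fps_mul /fps_Xn; case: leqP => nj.
  rewrite (bigD1 (Ordinal (nj : n < j.+1)%N)) //= eqxx mul1r big1 ?addr0 // => i ni.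
  by rewrite (_ : (i == n :> nat) = false) ?mul0r //; apply: negbTE ni.
rewrite big1 // => i _; rewrite (_ : (i == n :> nat) = false) ?mul0r //.
by apply: ltn_eqF; apply: leq_trans nj.
Qed.

(** Multiplying the indicator of the multiples of [n] by [1 - q^n] telescopes to 1; uniqueness of
    the inverse then avoids the recursion that defines [fps_inv]. *)
Lemma fps_inv_geometric n : (0 < n)%N ->
  fps_inv (fps_sub (@fps_one R) (@fps_Xn R n)) =1 (fun j => (n %| j)%:R).
Proof.
move=> n0; apply: fps_inv_unique.
  by rewrite /fps_sub /fps_one /fps_Xn eqxx (ltn_eqF n0) subr0 unitr1.
move=> j.
have -> : fps_mul (fps_sub (@fps_one R) (@fps_Xn R n)) (fun j => (n %| j)%:R) j =
    fps_mul (@fps_one R) (fun j => (n %| j)%:R) j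
    - fps_mul (@fps_Xn R n) (fun j => (n %| j)%:R) j.
  by rewrite /fps_mul -sumrB; apply: eq_bigr => i _; rewrite mulrBl.
rewrite fps_mul1 fps_Xn_mul /fps_one; case: leqP => nj.
  by rewrite dvdn_subl // subrr gtn_eqF // (leq_trans n0).
rewrite subr0; case: j nj => [|j] nj; first by rewrite dvdn0.
by rewrite gtnNdvd.
Qed.

Lemma lambert_termE (a : nat -> R) n j : (0 < n)%N -> (0 < j)%N ->
  lambert_term a n j = if (n %| j)%N then a n else 0.
Proof.
move=> n0 j0; rewrite /lambert_term /fps_scale fps_Xn_mul fps_inv_geometric //.
case: leqP => nj; last by rewrite mulr0 gtnNdvd.
by rewrite dvdn_subl //; case: ifP; rewrite ?mulr1 ?mulr0.
Qed.

Lemma inv_coef_sub (C : fps R) n k :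
  inv_coef C (n%:Z - k%:Z) = if (k <= n)%N then fps_inv C (n - k)%N else 0.
Proof.
case: leqP => kn; first by rewrite subzn.
(* In the [Negz] form [inv_coef] computes to 0. *)
have -> : n%:Z - k%:Z = Negz (k - n).-1.
  by rewrite NegzE prednK ?subn_gt0 // -subzn 1?ltnW // opprB.
by [].
Qed.

Lemma mx_entry_ord N (A : 'M[R]_N) (i j : 'I_N) : mx_entry A i.+1 j.+1 = A i j.
Proof. by rewrite /mx_entry /= !valK. Qed.

(** * Consequences of the factorization: coefficients, then matrices *)

Section Factorization.
Variables (C : fps R) (s : nat -> nat -> R).
Hypothesis hs : lambert_factorization C s.

Lemma factor_series_divisor_sum a j : (0 < j)%N ->
  fps_mul (fps_inv C) (factor_series s a) j = divisor_sum a j.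
Proof.
(* The cutoff lies past both the point of stabilization and every divisor of [j]. *)
move=> j0; have [N /(_ (maxn N j.+1) (leq_maxl _ _)) <-] := hs a j.
rewrite /divisor_sum (@sum_divisors _ a j (maxn N j.+1)) ?j0 ?leq_maxr //.
rewrite [RHS]big_mkcond; apply: eq_big_nat => n /andP[n0 _].
by rewrite lambert_termE.
Qed.

Lemma factor_series0 a : factor_series s a 0%N = 0. Proof. by []. Qed.

Lemma factor_seriesE a m : C 0%N = 1 ->
  factor_series s a m.+1 =
    divisor_sum a m.+1 + \sum_(1 <= k < m.+1) C k * divisor_sum a (m.+1 - k)%N.
Proof.
move=> hC; rewrite -[LHS]fps_mul1.
rewrite -(@eq_fps_mull (fps_mul C (fps_inv C))); last first.
  by move=> i _; rewrite fps_mulrV // hC unitr1.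
rewrite -fps_mulA {1}/fps_mul big_ord_recl hC mul1r subn0.
rewrite factor_series_divisor_sum //.
(* The last term, with [C m.+1], meets the constant coefficient of the other factor, which is 0;
   only positive indices remain, where the coefficients are divisor sums. *)
congr (_ + _); rewrite big_ord_recr /= /bump leq0n add1n subnn.
rewrite [fps_mul _ _ 0%N]big_ord1 factor_series0 !mulr0 addr0 big_add1 big_mkord.
apply: eq_bigr => i _.
by rewrite factor_series_divisor_sum // subn_gt0 ltnS.
Qed.

(** Indicator sequences extract the columns of the matrix [s], turning the factorization into an
    identity of matrices. *)
Lemma factor_series_delta k n : (0 < k)%N -> (0 < n)%N ->
  factor_series s (fun j => (j == k)%:R) n = if (k <= n)%N then s n k else 0.
Proof.
case: n => // n k0 _; rewrite /factor_series; case: leqP => kn.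
  rewrite (bigD1_seq k) ?iota_uniq ?mem_index_iota ?k0 //= eqxx mulr1.
  by rewrite big1 ?addr0 // => i /negPf->; rewrite mulr0.
rewrite big_nat big1 // => i /andP[_ i_n]; rewrite ltn_eqF ?mulr0 //.
exact: leq_trans kn.
Qed.

Lemma divisor_sum_delta k n : (0 < n)%N ->
  divisor_sum (fun j => (j == k)%:R : R) n = (k %| n)%:R.
Proof.
move=> n0; rewrite /divisor_sum dvdn_divisors //.
have [kn|kn] := boolP (k \in _).
  by rewrite (bigD1_seq k) ?divisors_uniq //= eqxx big1 ?addr0 // => i /negPf->.
by rewrite big_seq big1 // => i; case: eqP => // ->; rewrite (negPf kn).
Qed.

Let T N : 'M[R]_N := \matrix_(i, j) inv_coef C (i.+1%:Z - j.+1%:Z).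
Let D N : 'M[R]_N := \matrix_(i, j) (j.+1 %| i.+1)%:R.
Let M N : 'M[R]_N :=
  \matrix_(i, j) if (j.+1 %| i.+1)%N then (moebius (i.+1 %/ j.+1)%N)%:~R else 0.

Lemma inv_coef_mul_s N : T N *m s_matrix s N = D N.
Proof.
apply/matrixP => i k; rewrite !mxE -divisor_sum_delta //.
rewrite -factor_series_divisor_sum // fps_mulC /fps_mul big_ord_recl.
rewrite factor_series0 mul0r add0r.
(* The guard introduced by widening the range to [N] corresponds to the zeros of [T N] above the
   diagonal, where the index of [c] is negative. *)
rewrite (big_ord_widen N (fun j => factor_series s (fun l => (l == k.+1)%:R) j.+1 *
   fps_inv C (i.+1 - j.+1)%N)) // [RHS]big_mkcond; apply: eq_bigr => j _.
rewrite !mxE inv_coef_sub factor_series_delta // !ltnS.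
by case: ifP => _; rewrite ?mul0r // mulrC.
Qed.

Lemma dvdn_mul_moebius N : D N *m M N = 1%:M.
Proof.
apply/matrixP => i k; rewrite !mxE.
(* The entry is collected in the integers, where Moebius inversion was proved, and cast to [R]. *)
transitivity ((\sum_(d <- divisors i.+1 | (k.+1 %| d)%N) moebius (d %/ k.+1)%N)%:~R : R).
  rewrite [in RHS]big_mkcond (@sum_divisors_ord _ _ i.+1 N) ?ltn_ord // rmorph_sum /=.
  apply: eq_bigr => j _; rewrite !mxE; case: (j.+1 %| i.+1)%N; last by rewrite mul0r.
  by rewrite mul1r; case: ifP.
by rewrite sum_moebius_between // eqSS -val_eqE; case: eqP.
Qed.

(** For square matrices [D M = 1] yields [M D = 1], so [M T] is a left inverse of [S]. This already
    makes [S] a unit, so [invmx] is its true inverse. *)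
Lemma invmx_s_matrix N : invmx (s_matrix s N) = M N *m T N.
Proof.
have MTS : (M N *m T N) *m s_matrix s N = 1%:M.
  by rewrite -mulmxA inv_coef_mul_s; apply/mulmx1C/dvdn_mul_moebius.
have [_ uS] := mulmx1_unit MTS.
by rewrite -[LHS]mul1mx -MTS mulmxK.
Qed.

Lemma s_inv_moebius N n k : (0 < k <= n)%N -> (n <= N)%N ->
  s_inv s N n k =
    \sum_(d <- divisors n) inv_coef C (d%:Z - k%:Z) * (moebius (n %/ d)%N)%:~R.
Proof.
(* Both shifted indices are below [N], so [mx_entry] reads an actual entry rather than its default
   0. *)
case: k n => [|k] [|n] // kn nN; have kN := leq_trans kn nN.
rewrite /s_inv invmx_s_matrix (mx_entry_ord _ (Ordinal nN) (Ordinal kN)) mxE.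
rewrite (@sum_divisors_ord _ _ n.+1 N) //; apply: eq_bigr => j _; rewrite !mxE /=.
by case: ifP; rewrite ?mul0r // mulrC.
Qed.

Lemma inv_coef_s_inv N n k : (0 < k <= n)%N -> (n <= N)%N ->
  inv_coef C (n%:Z - k%:Z) = \sum_(d <- divisors n) s_inv s N d k.
Proof.
case: k n => [|k] [|n] // kn nN; have kN := leq_trans kn nN.
have : D N *m invmx (s_matrix s N) = T N.
  by rewrite invmx_s_matrix mulmxA dvdn_mul_moebius mul1mx.
move=> /matrixP/(_ (Ordinal nN) (Ordinal kN)); rewrite [RHS]mxE /= => <-.
rewrite mxE (@sum_divisors_ord _ _ n.+1 N) //; apply: eq_bigr => j _; rewrite mxE /=.
rewrite /s_inv (mx_entry_ord _ j (Ordinal kN)).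
by case: ifP; rewrite ?mul0r ?mul1r.
Qed.

End Factorization.
End PowerSeries.

Theorem theorem2 (R : comUnitRingType) (C : fps R) (s : nat -> nat -> R)
    (hC : C 0%N = 1) (hs : lambert_factorization C s) :
  (forall N n k : nat, (1 <= k)%N -> (k <= n)%N -> (n <= N)%N ->
     s_inv s N n k =
       \sum_(d <- divisors n)
          inv_coef C (d%:Z - k%:Z) * (moebius (n %/ d)%N)%:~R
     /\
     inv_coef C (n%:Z - k%:Z) = \sum_(d <- divisors n) s_inv s N d k)
  /\
  (forall (a : nat -> R) (m : nat),
     \sum_(1 <= k < m.+2) s m.+1 k * a k =
       divisor_sum a m.+1
       + \sum_(1 <= k < m.+1) C k * divisor_sum a (m.+1 - k)%N).
Proof.
split=> [N n k k0 kn nN|a m]; last exact: (factor_seriesE hs a m hC).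
by split; [apply: s_inv_moebius | apply: inv_coef_s_inv]; rewrite ?k0.
Qed.
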